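(* Let $\hat M = M(\hat{\bm x})$ be the plug-in maximum likelihood estimator and $L$ the average Kullback-Leibler loss in the multi-relational network model described in the context. Assume that $\bm x^* \in \Theta = \mathcal{E}^N \times \mathcal{R}^K$, where $\mathcal{E}$ and $\mathcal{R}$ are Euclidean balls of radius $U$, and that $|\phi(\bm u) - \phi(\bm v)| \le \alpha \|\bm u - \bm v\|$ for all $\bm u, \bm v \in \mathcal{E}^2 \times \mathcal{R}$. Let $C_1 = 18C$, $C_2 = 8\sqrt{3}\,\alpha U$ and $C_3 = 2\max\{C_1,C_2\}$. If $\frac{n}{m}\ge C_2+e$, then $$E\big[L(\hat M, M^* )\big] \leq C_3 \frac{m}{n} \log \frac{n}{m} + \frac{C_1}{n}\exp\left\{- m \log \frac{n}{m}\right\} + \frac{3}{n}\exp\left\{-\frac{1}{3}\left( n+ C_3\, m \log \frac{n}{m}\right)\right\}.$$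
   Context: Notation: $[N]=\{1,\dots,N\}$; $\sigma(x) = e^x/(1+e^x)$; $D(p\|q) = p\log\frac{p}{q} + (1-p)\log\frac{1-p}{1-q}$ is the Kullback-Leibler divergence between Bernoulli$(p)$ and Bernoulli$(q)$; $\|\cdot\|$ is the Euclidean norm. Model: There are $N$ entities and $K$ relations; $\Lambda = [N]\times[N]\times[K]$ is the set of edges. $\mathcal{E}\subset\mathbb{R}^{d_E}$ and $\mathcal{R}\subset\mathbb{R}^{d_R}$ are compact sets, $\Theta = \mathcal{E}^N\times\mathcal{R}^K$, and elements of $\Theta$ are written $\bm x = (\bm\theta_1,\dots,\bm\theta_N,\bm w_1,\dots,\bm w_K)$. For $\lambda=(i,j,k)\in\Lambda$ put $\bm x_\lambda = (\bm\theta_i,\bm\theta_j,\bm w_k)$. Given a score function $\phi:\mathcal{E}^2\times\mathcal{R}\to\mathbb{R}$, let $M_\lambda(\bm x) = \sigma(\phi(\bm x_\lambda))$ and $M(\bm x) = (M_\lambda(\bm x))_{\lambda\in\Lambda}$. The true parameter is $\bm x^*$, $M^* = M(\bm x^* )$, and the $Y_\lambda$, $\lambda\in\Lambda$, are independent Bernoulli$(M^*_\lambda)$ variables. Each edge is observed independently with probability $\gamma\in(0,1]$, independently of $Y$; $\mathcal{S}\subset\Lambda$ is the random set of observed edges. Put $n = \gamma N^2 K$ (expected number of observed edges), $m = N d_E + K d_R$ (dimension of $\Theta$), and $C = \sup_{\bm u\in\mathcal{E}^2\times\mathcal{R}}|\phi(\bm u)|$; it is assumed throughout that $C\ge 2$.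 Estimator: the log-likelihood is $l(\bm x;Y_{\mathcal{S}}) = \sum_{\lambda\in\mathcal{S}} \big[Y_\lambda\log M_\lambda(\bm x) + (1-Y_\lambda)\log(1-M_\lambda(\bm x))\big]$; $\hat{\bm x}$ is a maximizer of $l(\bm x;Y_{\mathcal{S}})$ over $\bm x\in\Theta$ (not necessarily unique), and $\hat M = M(\hat{\bm x})$. Loss: $L(\hat M,M^* ) = \frac{1}{|\Lambda|}\sum_{\lambda\in\Lambda} D(M^*_\lambda\|\hat M_\lambda)$. *)

(* Defs.v *)
From HB Require Import structures.
From mathcomp Require Import all_boot all_order all_algebra.
From mathcomp Require Import all_classical all_reals all_analysis.

Set Implicit Arguments.
Unset Strict Implicit.
Unset Printing Implicit Defensive.

Import Order.TTheory GRing.Theory Num.Theory.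
Import numFieldNormedType.Exports.

Local Open Scope classical_set_scope.
Local Open Scope ring_scope.

(* The library's norm `|v| on matrices is the sup norm. *)
Definition enorm (R : realType) (k : nat) (v : 'rV[R]_k) : R :=
  Num.sqrt (\sum_(i < k) v 0 i ^+ 2).

Definition eball (R : realType) (k : nat) (c : 'rV[R]_k) (r : R) :
    set 'rV[R]_k :=
  [set v | enorm (v - c) <= r].

Definition sigmoid (R : realType) (t : R) : R := expR t / (1 + expR t).

Definition bern_kl (R : realType) (p q : R) : R :=
  p * ln (p / q) + (1 - p) * ln ((1 - p) / (1 - q)).

(* Mutual independence of a finite family; the sets A i may be the whole space,
   so this contains the product rule for every subfamily. *)
Definition mutually_independent (d d' : measure_display)
    (T : measurableType d) (T' : measurableType d') (R : realType)
    (P : probability T R) (I : finType) (X : I -> {RV P >-> T'}) : Prop :=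
  forall A : I -> set T', (forall i, measurable (A i)) ->
    P (\bigcap_(i in [set: I]) (X i @^-1` A i)) =
    (\prod_(i : I) P (X i @^-1` A i))%E.

Notation edge N K := ('I_N * 'I_N * 'I_K)%type.

Section Network.
Variables (R : realType) (N K dE dR : nat).

(* (theta_1, ..., theta_N, w_1, ..., w_K) *)
Definition param : Type := (('I_N -> 'rV[R]_dE) * ('I_K -> 'rV[R]_dR))%type.

Definition param_space (E : set 'rV[R]_dE) (W : set 'rV[R]_dR) : set param :=
  [set x | (forall i, E (x.1 i)) /\ (forall k, W (x.2 k))].

(* E^2 x W, as a subset of the Euclidean space of dimension 2 dE + dR *)
Definition score_dom (E : set 'rV[R]_dE) (W : set 'rV[R]_dR) :
    set 'rV[R]_(dE + dE + dR) :=
  [set u | [/\ E (lsubmx (lsubmx u)), E (rsubmx (lsubmx u)) & W (rsubmx u)]].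

Definition edge_param (x : param) (l : edge N K) : 'rV[R]_(dE + dE + dR) :=
  row_mx (row_mx (x.1 l.1.1) (x.1 l.1.2)) (x.2 l.2).

Definition edge_prob (phi : 'rV[R]_(dE + dE + dR) -> R) (x : param)
    (l : edge N K) : R :=
  sigmoid (phi (edge_param x l)).

Definition score_bound (E : set 'rV[R]_dE) (W : set 'rV[R]_dR)
    (phi : 'rV[R]_(dE + dE + dR) -> R) : R :=
  sup [set `|phi u| | u in score_dom E W].

Definition loglik (phi : 'rV[R]_(dE + dE + dR) -> R) (S : {set edge N K})
    (y : edge N K -> bool) (x : param) : R :=
  \sum_(l in S) ((y l)%:R * ln (edge_prob phi x l)
                 + (1 - (y l)%:R) * ln (1 - edge_prob phi x l)).

Definition is_mle (E : set 'rV[R]_dE) (W : set 'rV[R]_dR)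
    (phi : 'rV[R]_(dE + dE + dR) -> R) (S : {set edge N K})
    (y : edge N K -> bool) (x : param) : Prop :=
  param_space E W x /\
  forall x', param_space E W x' -> loglik phi S y x' <= loglik phi S y x.

Definition kl_loss (Mhat Mstar : edge N K -> R) : R :=
  #|{: edge N K}|%:R^-1 * \sum_(l : edge N K) bern_kl (Mstar l) (Mhat l).

Definition expected_obs (gamma : R) : R := gamma * N%:R ^+ 2 * K%:R.

Definition param_dim : R := (N * dE + K * dR)%:R.

Section Sampling.
Variables (d : measure_display) (T : measurableType d) (P : probability T R).

Definition observed (O : edge N K -> {RV P >-> bool}) (t : T) :
    {set edge N K} := [set l | O l t]%SET.

(* Y l is the label of edge l and O l tells whether l is observed. Joint
   independence of all these variables covers the independence of the labels,
   that of the observations, and that of the two families. *)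
Definition network_model (phi : 'rV[R]_(dE + dE + dR) -> R) (gamma : R)
    (xstar : param) (Y O : edge N K -> {RV P >-> bool}) : Prop :=
  [/\ forall l A, distribution P (Y l) A =
                  bernoulli_prob (edge_prob phi xstar l) A,
      forall l A, distribution P (O l) A = bernoulli_prob gamma A &
      mutually_independent
        (fun i : edge N K + edge N K =>
           match i with inl l => Y l | inr l => O l end)].

End Sampling.
End Network.

Arguments expected_obs {R} N K gamma.
Arguments param_dim R N K dE dR : clear implicits.

(* Main.v *)
(* For two parameters x and x0, the square root of the likelihood ratio on one
   edge has mean 1 - gamma h^2, with h^2 the squared Hellinger distance between
   the two label laws. Hence, for a fixed g, the product over all edges of
   (observed ? sqrt (lik g / lik x0) : 1) * exp (gamma h^2) has mean at most 1,
   and so does its average over a prior on a grid of parameters. The MLE beats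
   x0, so at a grid point g close to the MLE the product of the square roots is
   at least about 1; bounding the average from below by the single term g gives
   gamma * sum h^2 <= log (1 / prior g) + log (average) + (rounding error), and
   E log (average) <= 0. Scores bounded by C give KL <= 8 C h^2, so no tail
   bound is needed and the two exponential terms of the theorem are slack.

   The prior is a product of two-sided geometric laws on the coordinates,
   measured in mesh steps from the centers of the balls. With mesh
   U / (rho sqrt d) and rho = (n / m)^2, log (1 / prior g) is at most
   m (1 + log (2 (1 + rho))) in every dimension d. *)

Require Import Defs.
From HB Require Import structures.
From mathcomp Require Import all_boot all_order all_algebra.
From mathcomp Require Import all_classical all_reals all_analysis.
From mathcomp Require Import measurable_realfun ring lra.

Set Implicit Arguments.
Unset Strict Implicit.
Unset Printing Implicit Defensive.

Import Order.TTheory GRing.Theory Num.Theory.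
Import numFieldNormedType.Exports.

Local Open Scope classical_set_scope.
Local Open Scope ring_scope.

(** * Exponential inequalities and Bernoulli divergences *)

Lemma subr_expRN_le (R : realType) (t : R) : 1 - expR (- t) <= t.
Proof. by have := expR_ge1Dx (- t); lra. Qed.

Lemma expR_sub1_le (R : realType) (t : R) :
  0 <= t -> t <= 1 -> expR (t / 2) - 1 <= t.
Proof.
move=> t0 t1; have := expR_ge1Dx (- (t / 2)).
rewrite expRN => h.
have e0 := expR_gt0 (t / 2).
have : (1 - t / 2) * expR (t / 2) <= 1.
  by rewrite -ler_pdivlMr// mul1r; lra.
nra.
Qed.

(** As [t] tends to minus infinity the left side grows like [- t] while the square stays below 1,
    hence a factor linear in [C]. *)
Lemma expR_taylor1_le_sqr (R : realType) (C t : R) :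
  2 <= C -> - (2 * C) <= t ->
  expR t - 1 - t <= 4 * C * (expR (t / 2) - 1) ^+ 2.
Proof.
move=> hC ht; have w0 := expR_gt0 (t / 2).
have -> : expR t = expR (t / 2) ^+ 2 by rewrite -expRM_natl; congr expR; lra.
have tw : 2 - 2 / expR (t / 2) <= t.
  by have := subr_expRN_le (t / 2); rewrite expRN; lra.
set w := expR (t / 2) in w0 tw *.
(* For [w >= 2 / 7] the bound [tw] leaves the factor [1 + 2 / w <= 8 <= 4 * C]. Below that,
   [(w - 1) ^+ 2 >= 25 / 49 > 1 / 2], while the left side is at most [- t <= 2 * C]. *)
have [w27|w27] := leP (2 / 7) w.
- have {}tw : w ^+ 2 - 1 - t <= w ^+ 2 - 3 + 2 / w by lra.
  apply: (le_trans tw).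
  have -> : w ^+ 2 - 3 + 2 / w = (w - 1) ^+ 2 * (1 + 2 / w).
    by field; rewrite gt_eqF.
  rewrite mulrC ler_wpM2r ?sqr_ge0//.
  have : 2 / w <= 7 by rewrite ler_pdivrMr//; lra.
  lra.
- have h1 : 25 / 49 <= (w - 1) ^+ 2 by nra.
  have h2 : w ^+ 2 <= 1 by nra.
  nra.
Qed.

Definition loglr (R : realType) (p q : R) (b : bool) : R :=
  ln (bernoulli_pmf p b) - ln (bernoulli_pmf q b).

(* Squared Hellinger distance, [1 - sum_b sqrt (p_b q_b)]. *)
Definition hellinger2 (R : realType) (p q : R) : R :=
  1 - \sum_b bernoulli_pmf p b * expR (loglr q p b / 2).

Lemma sum_bool (V : nmodType) (F : bool -> V) :
  \sum_b F b = F true + F false.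
Proof. by rewrite big_bool. Qed.

Lemma bernoulli_pmf_gt0 (R : realType) (p : R) b :
  0 < p < 1 -> 0 < bernoulli_pmf p b.
Proof. by case: b => /=; lra. Qed.

Lemma bernoulli_pmf_expR_loglr (R : realType) (p q : R) b :
  0 < p < 1 -> 0 < q < 1 ->
  bernoulli_pmf p b * expR (loglr q p b) = bernoulli_pmf q b.
Proof.
move=> /(@bernoulli_pmf_gt0 _ _ b) p0 /(@bernoulli_pmf_gt0 _ _ b) q0.
by rewrite /loglr expRB !lnK ?posrE// mulrC divfK// gt_eqF.
Qed.

Lemma bern_kl_loglr (R : realType) (p q : R) :
  0 < p < 1 -> 0 < q < 1 ->
  bern_kl p q = \sum_b bernoulli_pmf p b * loglr p q b.
Proof.
move=> hp hq; rewrite sum_bool /bern_kl /loglr /=.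
by rewrite !ln_div ?posrE//; lra.
Qed.

(* The first-order terms cancel because both masses sum to 1. *)
Lemma bern_kl_taylor (R : realType) (p q : R) :
  0 < p < 1 -> 0 < q < 1 ->
  bern_kl p q =
  \sum_b bernoulli_pmf p b * (expR (loglr q p b) - 1 - loglr q p b).
Proof.
move=> hp hq; rewrite bern_kl_loglr// !sum_bool !mulrBr.
rewrite !bernoulli_pmf_expR_loglr//= /loglr /=; ring.
Qed.

Lemma hellinger2_sqr (R : realType) (p q : R) :
  0 < p < 1 -> 0 < q < 1 ->
  2 * hellinger2 p q =
  \sum_b bernoulli_pmf p b * (expR (loglr q p b / 2) - 1) ^+ 2.
Proof.
move=> hp hq; rewrite /hellinger2 !sum_bool.
have E b : expR (loglr q p b / 2) ^+ 2 = expR (loglr q p b).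
  by rewrite -expRM_natl; congr expR; lra.
have /= := @bernoulli_pmf_expR_loglr _ _ _ true hp hq.
have /= := @bernoulli_pmf_expR_loglr _ _ _ false hp hq.
rewrite -!E.
set u := expR (loglr q p true / 2); set v := expR (loglr q p false / 2).
by rewrite /= => h1 h2; nra.
Qed.

Lemma bern_kl_ge0 (R : realType) (p q : R) :
  0 < p < 1 -> 0 < q < 1 -> 0 <= bern_kl p q.
Proof.
move=> hp hq; rewrite bern_kl_taylor//; apply: sumr_ge0 => b _.
apply: mulr_ge0; first exact/ltW/bernoulli_pmf_gt0.
by have := expR_ge1Dx (loglr q p b); lra.
Qed.

(** The Taylor remainder bound is applied label by label with [t = loglr q p b]; [8 * C] is its
    [4 * C] times the 2 of [hellinger2_sqr]. *)
Lemma bern_kl_le_hellinger2 (R : realType) (C p q : R) :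
  0 < p < 1 -> 0 < q < 1 -> 2 <= C ->
  (forall b, loglr p q b <= 2 * C) ->
  bern_kl p q <= 8 * C * hellinger2 p q.
Proof.
move=> hp hq hC hl.
have -> : 8 * C * hellinger2 p q = 4 * C * (2 * hellinger2 p q) by ring.
rewrite bern_kl_taylor// hellinger2_sqr// mulr_sumr; apply: ler_sum => b _.
rewrite [leRHS]mulrCA ler_wpM2l//; first exact/ltW/bernoulli_pmf_gt0.
apply: expR_taylor1_le_sqr => //.
by have := hl b; rewrite /loglr; lra.
Qed.

(** The difference of the two divergences is the [p]-mean of [loglr q' q]. *)
Lemma bern_kl_perturb (R : realType) (e p q q' : R) :
  0 < p < 1 -> 0 < q < 1 -> 0 < q' < 1 ->
  (forall b, loglr q' q b <= e) ->
  bern_kl p q <= bern_kl p q' + e.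
Proof.
move=> hp hq hq' hl; rewrite !bern_kl_loglr// !sum_bool.
have := hl true; have := hl false; rewrite /loglr /=.
move: (ln _) (ln _) (ln _) (ln _) (ln _) (ln _) => *; nra.
Qed.

(** * Sigmoid probabilities *)

Lemma sigmoid_itv (R : realType) (t : R) : 0 < sigmoid t < 1.
Proof.
have e0 := expR_gt0 t; have e1 : 0 < 1 + expR t by lra.
by rewrite /sigmoid divr_gt0//= ltr_pdivrMr//; lra.
Qed.

(** Since [1 - sigmoid t = sigmoid (- t)], one Lipschitz estimate serves both labels. *)
Lemma bernoulli_pmf_sigmoid (R : realType) (t : R) b :
  bernoulli_pmf (sigmoid t) b = sigmoid (if b then t else - t).
Proof.
have e0 := expR_gt0 t; case: b => //=; rewrite /sigmoid expRN; field.
by rewrite !gt_eqF//; lra.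
Qed.

(** The derivative of [ln (sigmoid t)] lies between 0 and 1. The proof exponentiates and clears
    denominators, splitting on the order of [s] and [t]. *)
Lemma ln_sigmoid_lip (R : realType) (s t : R) :
  ln (sigmoid s) - ln (sigmoid t) <= `|s - t|.
Proof.
have [s0 _] := andP (sigmoid_itv s); have [t0 _] := andP (sigmoid_itv t).
rewrite lerBlDr -[leLHS]expRK -[leRHS]expRK ler_ln ?posrE ?expR_gt0//.
rewrite expRD !lnK ?posrE//.
have es := expR_gt0 s; have et := expR_gt0 t.
have -> : sigmoid s = (expR (s - t) / (1 + expR s)) * expR t.
  by rewrite /sigmoid expRB; field; rewrite !gt_eqF//; lra.
have -> : expR `|s - t| * sigmoid t = (expR `|s - t| / (1 + expR t)) * expR t.
  by rewrite /sigmoid; ring.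
rewrite ler_pM2r//.
have es1 : 0 < 1 + expR s by lra.
have et1 : 0 < 1 + expR t by lra.
rewrite ler_pdivrMr// mulrAC ler_pdivlMr//.
have [st|st] := leP t s.
  rewrite ger0_norm ?subr_ge0// ler_pM2l ?expR_gt0//.
  by have : expR t <= expR s; [rewrite ler_expR|lra].
rewrite ltr0_norm ?subr_lt0// opprB !expRB.
have lt_st : expR s < expR t by rewrite ltr_expR.
rewrite mulrDr mulr1 divfK ?gt_eqF// mulrDr mulr1 divfK ?gt_eqF//.
apply: lerD; last exact/ltW.
by rewrite (@le_trans _ _ 1)// ?ler_pdivrMr// ?ler_pdivlMr// mul1r ltW.
Qed.

Lemma loglr_sigmoid_le (R : realType) (s t : R) b :
  loglr (sigmoid s) (sigmoid t) b <= `|s - t|.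
Proof.
rewrite /loglr !bernoulli_pmf_sigmoid (le_trans (ln_sigmoid_lip _ _))//.
by case: b => //; rewrite -opprD normrN.
Qed.

Lemma hellinger2_ge0 (R : realType) (p q : R) :
  0 < p < 1 -> 0 < q < 1 -> 0 <= hellinger2 p q.
Proof.
move=> hp hq; suff : 0 <= 2 * hellinger2 p q by rewrite pmulr_rge0.
rewrite hellinger2_sqr//; apply: sumr_ge0 => b _.
by rewrite mulr_ge0 ?sqr_ge0// ltW// bernoulli_pmf_gt0.
Qed.

(** * Tilted likelihood ratios and their mixture *)

Definition obs_prob (R : realType) (I : finType) (p : I -> R) (gam : R)
    (c : {ffun I -> bool * bool}) : R :=
  \prod_i (bernoulli_pmf (p i) (c i).1 * bernoulli_pmf gam (c i).2).

(** The factor of one edge; [yo] holds the label and the observation flag. The slack [e] pays for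
    moving the maximizer to a grid point on an observed edge, and [- gam * e] in the second exponent
    restores a mean of at most 1. *)
Definition tilt (R : realType) (gam e p q : R) (yo : bool * bool) : R :=
  (if yo.2 then expR ((e + loglr q p yo.1) / 2) else 1) *
  expR (gam * (hellinger2 p q - e)).

Lemma sum_bool2 (V : nmodType) (F : bool * bool -> V) :
  \sum_yo F yo = \sum_b (F (b, true) + F (b, false)).
Proof.
rewrite (eq_bigr (fun yo => F (yo.1, yo.2))); last by case.
rewrite -(pair_bigA _ (fun b b' => F (b, b'))) /=.
by apply: eq_bigr => b _; rewrite sum_bool.
Qed.

(** With [h = hellinger2 p q], the mean is [(1 - gam + gam * expR (e / 2) * (1 - h)) * expR (gam *
    (h - e))]. As [expR (e / 2) <= 1 + e], the first factor is at most [1 + gam * (e - h) <= expR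
    (gam * (e - h))]. *)
Lemma tilt_mean_le1 (R : realType) (gam e p q : R) :
  0 < p < 1 -> 0 < q < 1 -> 0 <= gam -> 0 <= e <= 1 ->
  \sum_yo bernoulli_pmf p yo.1 * bernoulli_pmf gam yo.2 * tilt gam e p q yo
    <= 1.
Proof.
move=> hp hq g0 /andP[e0 e1]; rewrite sum_bool2.
set x := expR (gam * (hellinger2 p q - e)).
rewrite (eq_bigr (fun b => (bernoulli_pmf p b * (1 - gam) +
    gam * expR (e / 2) * (bernoulli_pmf p b * expR (loglr q p b / 2))) * x)).
  2: by move=> b _; rewrite /tilt -/x /= mulrDl expRD; ring.
rewrite -mulr_suml big_split /= -mulr_suml -mulr_sumr.
have -> : \sum_b bernoulli_pmf p b = 1 by rewrite sum_bool /= subrKC.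
have -> : \sum_b bernoulli_pmf p b * expR (loglr q p b / 2) =
  1 - hellinger2 p q by rewrite /hellinger2; ring.
have h0 := hellinger2_ge0 hp hq.
have h1 : 0 <= 1 - hellinger2 p q.
  rewrite /hellinger2 subKr; apply: sumr_ge0 => b _.
  by rewrite mulr_ge0 ?expR_ge0// ltW// bernoulli_pmf_gt0.
rewrite -ler_pdivlMr ?expR_gt0// div1r -expRN.
apply: le_trans (expR_ge1Dx _).
have := expR_sub1_le e0 e1; set y := expR _ => hy.
have : y * (1 - hellinger2 p q) <= (1 + e) * (1 - hellinger2 p q).
  by rewrite ler_wpM2r//; lra.
set h := hellinger2 p q in h0 h1 *.
move=> hyh.
have {}hyh : gam * (y * (1 - h)) <= gam * (1 + e - h).
  by rewrite ler_wpM2l//; nra.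
lra.
Qed.

Lemma obs_prob_prod (R : realType) (I : finType) (p : I -> R) (gam : R)
    (F : I -> bool * bool -> R) :
  \sum_c obs_prob p gam c * \prod_i F i (c i) =
  \prod_i \sum_yo
    bernoulli_pmf (p i) yo.1 * bernoulli_pmf gam yo.2 * F i yo.
Proof.
rewrite bigA_distr_bigA; apply: eq_bigr => c _.
by rewrite /obs_prob -big_split.
Qed.

Lemma obs_prob_sum1 (R : realType) (I : finType) (p : I -> R) (gam : R) :
  \sum_c obs_prob p gam c = 1.
Proof.
have := obs_prob_prod p gam (fun _ _ => 1).
rewrite (eq_bigr (obs_prob p gam)); last by move=> c _; rewrite big1 ?mulr1.
move=> ->; rewrite big1// => i _.
by rewrite sum_bool2 sum_bool /=; ring.
Qed.

Definition mixture (R : realType) (I J : finType) (w : J -> R) (gam e : R)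
    (p : I -> R) (q : J -> I -> R) (c : {ffun I -> bool * bool}) : R :=
  \sum_j w j * \prod_i tilt gam e (p i) (q j i) (c i).

Lemma mixture_mean_le1 (R : realType) (I J : finType) (w : J -> R) (gam e : R)
    (p : I -> R) (q : J -> I -> R) :
  (forall i, 0 < p i < 1) -> (forall j i, 0 < q j i < 1) ->
  0 < gam <= 1 -> 0 <= e <= 1 ->
  (forall j, 0 <= w j) -> \sum_j w j <= 1 ->
  \sum_c obs_prob p gam c * mixture w gam e p q c <= 1.
Proof.
move=> hp hq hg he w0 w1.
under eq_bigr do rewrite mulr_sumr.
rewrite exchange_big /=; apply: le_trans w1; apply: ler_sum => j _.
under eq_bigr do rewrite mulrCA.
rewrite -mulr_sumr ler_piMr//.
rewrite (obs_prob_prod p gam (fun i => tilt gam e (p i) (q j i))).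
apply: prodr_ile1 => i _; apply/andP; split.
  apply: sumr_ge0 => yo _; rewrite !mulr_ge0 ?expR_ge0//.
  - exact/ltW/bernoulli_pmf_gt0.
  - by apply: bernoulli_pmf_ge0; lra.
  - by case: ifP => // _; exact: expR_ge0.
by apply: tilt_mean_le1 => //; lra.
Qed.

(** The logarithm of the mixture enters through its upper bound [mixture - 1], which is affine, so
    its mean follows at once from that of the mixture. *)
Lemma hellinger2_le_mixture (R : realType) (I J : finType) (w : J -> R)
    (gam e a : R) (p : I -> R) (q : J -> I -> R)
    (c : {ffun I -> bool * bool}) (j : J) :
  (forall k, 0 <= w k) -> expR (- a) <= w j ->
  0 <= \sum_(i | (c i).2) (e + loglr (q j i) (p i) (c i).1) ->
  gam * \sum_i hellinger2 (p i) (q j i) <=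
  gam * #|I|%:R * e + a + (mixture w gam e p q c - 1).
Proof.
move=> w0 wj hS.
set s := gam * _; set n := gam * #|I|%:R * e.
suff h : expR (- a) * expR (s - n) <= mixture w gam e p q c.
  by have := expR_ge1Dx (- a + (s - n)); rewrite expRD; lra.
rewrite /mixture (bigD1 j)//= -[leLHS]addr0; apply: lerD; last first.
  apply: sumr_ge0 => k _; rewrite mulr_ge0// prodr_ge0// => i _.
  by rewrite mulr_ge0 ?expR_ge0//; case: ifP => // _; exact: expR_ge0.
apply: ler_pM; rewrite ?expR_ge0//.
rewrite big_split /= -expR_sum -mulr_sumr sumrB sumr_const -[e *+ _]mulr_natl.
rewrite mulrBr (mulrA gam) -/s -/n ler_peMl ?expR_ge0//.
(* The remaining factor is the exponential of half the sum in [hS], hence at least 1. *)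
rewrite -big_mkcond /= -expR_sum -mulr_suml.
apply: le_trans (expR_ge1Dx _); rewrite lerDl mulr_ge0//.
Qed.

(** * Law of the labels and observations *)

Lemma expectation_le_finite d (T : measurableType d) (R : realType)
    (P : probability T R) (F : finType) (Z : T -> F) (mu g : F -> R)
    (f : T -> R) :
  (forall c, measurable (Z @^-1` [set c])) ->
  (forall c, P (Z @^-1` [set c]) = (mu c)%:E) ->
  measurable_fun setT f -> (forall t, 0 <= f t) ->
  (forall t, f t <= g (Z t)) ->
  ('E_P[f] <= (\sum_c mu c * g c)%:E)%E.
Proof.
move=> mZ PZ mf f0 fg; rewrite unlock.
(* The space is cut into the fibers of [Z]. Only the bound [g] is constant on them: [f] may vary
   there, as tied maximizers may be chosen differently for the same data. *)
have TE : [set: T] = \big[setU/set0]_(c <- enum F) (Z @^-1` [set c]).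
  apply/seteqP; split => // t _; rewrite -bigcup_seq.
  by exists (Z t) => //=; rewrite mem_enum.
rewrite TE ge0_integral_bigsetU ?enum_uniq//; last 3 first.
- by move=> c c' _ _ [t [<- <-]].
- by rewrite -TE; exact/measurable_EFinP.
- by move=> t _; rewrite lee_fin.
rewrite big_enum /= -sumEFin; apply: lee_sum => c _.
apply: (@le_trans _ _ (\int[P]_(t in Z @^-1` [set c]) (g c)%:E)%E).
  apply: ge0_le_integral => //.
  - by move=> t _; rewrite lee_fin.
  - by apply: measurable_funTS; exact/measurable_EFinP.
  - by move=> t /= <-; rewrite lee_fin.
by rewrite integral_cst// EFinM -PZ muleC.
Qed.

Lemma bernoulli_prob_set1 (R : realType) (p : R) b :
  0 <= p <= 1 -> bernoulli_prob p [set b] = (bernoulli_pmf p b)%:E.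
Proof.
move=> hp; rewrite bernoulli_probE// !diracE; case: b => /=.
- by rewrite mem_set// memNset//= mule1 mule0 adde0.
- by rewrite memNset// mem_set//= mule1 mule0 add0e.
Qed.

Section NetworkLaw.
Context (R : realType) (N K dE dR : nat).
Context (phi : 'rV[R]_(dE + dE + dR) -> R) (gamma : R).
Context (xstar : param R N K dE dR).
Context (d : measure_display) (T : measurableType d) (P : probability T R).
Context (Y O : edge N K -> {RV P >-> bool}).
Hypothesis hmodel : network_model phi gamma xstar Y O.
Hypothesis hgamma : 0 < gamma <= 1.

Definition config (t : T) : {ffun edge N K -> bool * bool} :=
  [ffun l => (Y l t, O l t)].

Let XX (i : edge N K + edge N K) : {RV P >-> bool} :=
  match i with inl l => Y l | inr l => O l end.

Let val_at (c : {ffun edge N K -> bool * bool}) (i : edge N K + edge N K) :=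
  match i with inl l => (c l).1 | inr l => (c l).2 end.

Let config_preimage c :
  config @^-1` [set c] = \bigcap_(i in [set: _]) (XX i @^-1` [set val_at c i]).
Proof.
apply/seteqP; split=> t /=.
  by move=> <- [l|l] _ /=; rewrite ffunE.
move=> h; apply/ffunP => l; rewrite ffunE.
have /= -> := h (inl l) I; have /= -> := h (inr l) I.
by case: (c l).
Qed.

Lemma measurable_config c : measurable (config @^-1` [set c]).
Proof.
rewrite config_preimage; apply: fin_bigcap_measurable => // i _.
by rewrite -[X in measurable X]setTI; exact: measurable_funPT.
Qed.

(** A configuration is an intersection of singleton events over all labels and flags, so mutual
    independence over the sum type yields the product mass. *)
Lemma prob_config c :
  P (config @^-1` [set c]) = (obs_prob (edge_prob phi xstar) gamma c)%:E.
Proof.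
case: hmodel => hY hO hind.
rewrite config_preimage (hind (fun i => [set val_at c i]))//.
rewrite big_sumType /= /obs_prob big_split EFinM -!prodEFin.
congr (_ * _)%E; apply: eq_bigr => l _.
- have := hY l [set (c l).1]; rewrite /distribution /pushforward /= => ->.
  have /andP[/ltW p0 /ltW p1] := sigmoid_itv (phi (edge_param xstar l)).
  by rewrite bernoulli_prob_set1//; exact/andP.
- have := hO l [set (c l).2]; rewrite /distribution /pushforward /= => ->.
  case/andP: hgamma => /ltW g0 g1.
  by rewrite bernoulli_prob_set1//; exact/andP.
Qed.

End NetworkLaw.

(** * Euclidean norm and rounding to a grid *)

Lemma enorm_ge0 (R : realType) k (v : 'rV[R]_k) : 0 <= enorm v.
Proof. exact: sqrtr_ge0. Qed.

Lemma enorm_sqr (R : realType) k (v : 'rV[R]_k) :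
  enorm v ^+ 2 = \sum_(i < k) v 0 i ^+ 2.
Proof. by rewrite sqr_sqrtr// sumr_ge0// => i _; exact: sqr_ge0. Qed.

Lemma enorm_le (R : realType) k (v : 'rV[R]_k) (r : R) :
  0 <= r -> (enorm v <= r) = (\sum_(i < k) v 0 i ^+ 2 <= r ^+ 2).
Proof. by move=> r0; rewrite -enorm_sqr ler_sqr// nnegrE enorm_ge0. Qed.

Lemma enorm_row_mx (R : realType) k l (u : 'rV[R]_k) (v : 'rV[R]_l) :
  enorm (row_mx u v) ^+ 2 = enorm u ^+ 2 + enorm v ^+ 2.
Proof.
rewrite !enorm_sqr big_split_ord /=.
by congr (_ + _); apply: eq_bigr => i _; rewrite (row_mxEl, row_mxEr).
Qed.

(** Zero has two codes, one per sign, and the prior gives weight to both. *)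
Definition signed_step (R : realType) B (h : R) (z : bool * 'I_B) : R :=
  (-1) ^+ z.1 * (z.2%:R * h).

(** Truncating the absolute value brings no coordinate farther from 0, so a rounded point stays in
    its ball. *)
Lemma round_toward0 (R : realType) B (h x : R) :
  0 < h -> `|x| < B%:R * h ->
  exists z : bool * 'I_B, `|signed_step h z| <= `|x| /\
                          `|x - signed_step h z| <= h.
Proof.
move=> h0 xB; have x0 : 0 <= `|x| / h by rewrite divr_ge0// ltW.
have /andP[k1 k2] := truncn_itv x0; set k := Num.truncn _ in k1 k2.
have kB : (k < B)%N.
  by rewrite -(ltr_nat R) (le_lt_trans k1)// ltr_pdivrMr.
exists (x < 0, Ordinal kB); rewrite /signed_step /=.
have kh : k%:R * h <= `|x| by rewrite -ler_pdivlMr.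
split.
  by rewrite normrM normr_sign mul1r ger0_norm// mulr_ge0// ltW.
rewrite [X in `|X - _|]numEsign ?num_real// -mulrBr normrM normr_sign mul1r.
rewrite ger0_norm ?subr_ge0//.
move: k2; rewrite ltr_pdivrMr// -natr1; lra.
Qed.

(** Errors of one mesh step in each of [d] coordinates amount to a Euclidean distance of
    [U / rho]. *)
Definition mesh (R : realType) (U rho : R) (d : nat) : R :=
  U / (rho * Num.sqrt d%:R).

(* Counting steps by AM-GM, [2 k <= rho + k ^ 2 / rho], avoids any factor
   depending on the dimension. *)
Lemma round_ball (R : realType) (U rho : R) d B (v : 'rV[R]_d) :
  0 < U -> 0 < rho -> d%:R * rho < B%:R -> enorm v <= U ->
  exists z : 'I_d -> bool * 'I_B,
    let g := \row_i signed_step (mesh U rho d) (z i) in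
    [/\ enorm g <= U, enorm (v - g) <= U / rho &
        \sum_i (z i).2%:R <= rho * d%:R].
Proof.
(* In dimension 0 the mesh is a division by zero; the empty row meets all three bounds. *)
case: d v => [|d] v U0 rho0 hB vU.
  have B0 : (0 < B)%N by move: hB; rewrite mul0r ltr0n.
  exists (fun=> (false, Ordinal B0)); rewrite /enorm !big_ord0 sqrtr0 mulr0.
  by split; rewrite ?divr_ge0 ?(ltW U0) ?(ltW rho0).
have vU2 : \sum_i v 0 i ^+ 2 <= U ^+ 2 by rewrite -enorm_le// ltW.
have d1 : 1 <= d.+1%:R :> R by rewrite ler1n.
have s0 : 0 < Num.sqrt d.+1%:R :> R by rewrite sqrtr_gt0; lra.
set h := mesh U rho d.+1.
have h0 : 0 < h by rewrite divr_gt0// mulr_gt0.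
have h2 : h ^+ 2 = U ^+ 2 / (rho ^+ 2 * d.+1%:R).
  by rewrite /h /mesh expr_div_n exprMn sqr_sqrtr//; lra.
have /choice[z hz] : forall i : 'I_d.+1, exists z : bool * 'I_B,
    `|signed_step h z| <= `|v 0 i| /\ `|v 0 i - signed_step h z| <= h.
  move=> i; apply: round_toward0 => //.
  have viU : `|v 0 i| <= U.
    rewrite -ler_sqr ?nnegrE ?(ltW U0)// real_normK ?num_real//.
    apply: le_trans vU2; rewrite (bigD1 i)//= lerDl sumr_ge0// => j _.
    exact: sqr_ge0.
  apply: (le_lt_trans viU).
  (* The index cutoff is large enough because [U / h] is [rho] times the square root of the
     dimension, at most [rho * d.+1%:R < B%:R]. *)
  apply: (@le_lt_trans _ _ (d.+1%:R * rho * h)); last by rewrite ltr_pM2r.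
  have -> : d.+1%:R * rho * h = U * Num.sqrt d.+1%:R.
    rewrite /h /mesh -{1}(@sqr_sqrtr _ d.+1%:R) ?expr2; last by lra.
    by field; rewrite !gt_eqF.
  by rewrite ler_peMr ?(ltW U0)// -[leLHS]sqrtr1 ler_sqrt//; lra.
exists z => g; split.
- rewrite enorm_le ?(ltW U0)//; apply: le_trans vU2; apply: ler_sum => i _.
  rewrite mxE -[leLHS]real_normK ?num_real// -[leRHS]real_normK ?num_real//.
  by rewrite ler_sqr ?nnegrE//; case: (hz i).
- rewrite enorm_le ?divr_ge0 ?(ltW U0) ?(ltW rho0)//.
  apply: (@le_trans _ _ (\sum_(i < d.+1) h ^+ 2)).
    apply: ler_sum => i _; rewrite !mxE -[leLHS]real_normK ?num_real//.
    by rewrite ler_sqr ?nnegrE// ?(ltW h0)//; case: (hz i).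
  rewrite sumr_const card_ord -[_ *+ d.+1]mulr_natl h2.
  rewrite le_eqVlt; apply/orP; left; apply/eqP; field.
  by rewrite !gt_eqF//; lra.
(* A step count times the mesh is at most the absolute value of the coordinate, so the squared
   counts sum to at most [(U / h) ^+ 2]. *)
- have S2 : \sum_i (z i).2%:R ^+ 2 <= rho ^+ 2 * d.+1%:R.
    have : (\sum_i (z i).2%:R ^+ 2) * h ^+ 2 <= U ^+ 2.
      apply: le_trans vU2; rewrite mulr_suml; apply: ler_sum => i _.
      rewrite -exprMn -[leRHS]real_normK ?num_real// ler_sqr ?nnegrE//.
        case: (hz i) => + _; rewrite /signed_step normrM normr_sign mul1r.
        by rewrite ger0_norm// mulr_ge0// ltW.
      by rewrite mulr_ge0// ltW.
    have r2d : 0 < rho ^+ 2 * d.+1%:R by rewrite mulr_gt0 ?exprn_gt0.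
    by rewrite h2 mulrA ler_pdivrMr// [_ * U ^+ 2]mulrC ler_pM2l// exprn_gt0.
  apply: (@le_trans _ _ (\sum_i (rho / 2 + (z i).2%:R ^+ 2 / (2 * rho)))).
    apply: ler_sum => i _; set k := (z i).2%:R.
    have -> : rho / 2 + k ^+ 2 / (2 * rho) = k + (rho - k) ^+ 2 / (2 * rho).
      by field; rewrite gt_eqF.
    by rewrite lerDl divr_ge0 ?sqr_ge0// mulr_ge0// ltW.
  rewrite big_split /= sumr_const card_ord -mulr_suml -[_ *+ d.+1]mulr_natl.
  have : (\sum_i (z i).2%:R ^+ 2) / (2 * rho) <= rho * d.+1%:R / 2.
    rewrite ler_pdivrMr ?mulr_gt0//; apply: (le_trans S2).
    by rewrite le_eqVlt; apply/orP; left; apply/eqP; field.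
  lra.
Qed.

Local Notation coord N K dE dR := ('I_N * 'I_dE + 'I_K * 'I_dR)%type.

Definition grid_point (R : realType) N K dE dR B (U rho : R)
    (cE : 'rV[R]_dE) (cR : 'rV[R]_dR) (z : coord N K dE dR -> bool * 'I_B) :
    param R N K dE dR :=
  (fun i => cE + \row_a signed_step (mesh U rho dE) (z (inl (i, a))),
   fun k => cR + \row_a signed_step (mesh U rho dR) (z (inr (k, a)))).

Lemma round_param (R : realType) N K dE dR B (U rho : R)
    (cE : 'rV[R]_dE) (cR : 'rV[R]_dR) (x : param R N K dE dR) :
  0 < U -> 0 < rho -> (dE + dR)%:R * rho < B%:R ->
  param_space (eball cE U) (eball cR U) x ->
  exists z : {ffun coord N K dE dR -> bool * 'I_B},
    let g := grid_point U rho cE cR z in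
    [/\ param_space (eball cE U) (eball cR U) g,
        forall i, enorm (x.1 i - g.1 i) <= U / rho,
        forall k, enorm (x.2 k - g.2 k) <= U / rho &
        \sum_s (z s).2%:R <= rho * param_dim R N K dE dR].
Proof.
move=> U0 rho0; rewrite natrD mulrDl => hB [xE xR].
have nE : 0 <= dE%:R * rho by rewrite mulr_ge0// ltW.
have nR : 0 <= dR%:R * rho by rewrite mulr_ge0// ltW.
have /choice[zE hE] : forall i, exists z : 'I_dE -> bool * 'I_B,
    let g := \row_a signed_step (mesh U rho dE) (z a) in
    [/\ enorm g <= U, enorm (x.1 i - cE - g) <= U / rho &
        \sum_a (z a).2%:R <= rho * dE%:R].
  by move=> i; apply: round_ball => //; [lra | exact: xE].
have /choice[zR hR] : forall k, exists z : 'I_dR -> bool * 'I_B,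
    let g := \row_a signed_step (mesh U rho dR) (z a) in
    [/\ enorm g <= U, enorm (x.2 k - cR - g) <= U / rho &
        \sum_a (z a).2%:R <= rho * dR%:R].
  by move=> k; apply: round_ball => //; [lra | exact: xR].
pose z : {ffun coord N K dE dR -> bool * 'I_B} := [ffun s => match s with
  inl s => zE s.1 s.2 | inr s => zR s.1 s.2 end].
have gE i : (grid_point U rho cE cR z).1 i =
    cE + \row_a signed_step (mesh U rho dE) (zE i a).
  by congr (_ + _); apply/rowP => a; rewrite !mxE ffunE.
have gR k : (grid_point U rho cE cR z).2 k =
    cR + \row_a signed_step (mesh U rho dR) (zR k a).
  by congr (_ + _); apply/rowP => a; rewrite !mxE ffunE.
exists z => g; split.
- split=> [i|k].
    by rewrite /eball; red; rewrite gE addrC addKr; case: (hE i).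
  by rewrite /eball; red; rewrite gR addrC addKr; case: (hR k).
- by move=> i; rewrite gE opprD addrA; case: (hE i).
- by move=> k; rewrite gR opprD addrA; case: (hR k).
rewrite big_sumType /= /param_dim natrD !natrM mulrDr; apply: lerD.
  rewrite (eq_bigr (fun s => (zE s.1 s.2).2%:R)); last first.
    by move=> s _; rewrite ffunE.
  rewrite -(pair_bigA _ (fun i a => (zE i a).2%:R)) /=.
  apply: (@le_trans _ _ (\sum_(i < N) rho * dE%:R)).
    by apply: ler_sum => i _; case: (hE i).
  by rewrite sumr_const card_ord -[_ *+ N]mulr_natl mulrCA.
rewrite (eq_bigr (fun s => (zR s.1 s.2).2%:R)); last first.
  by move=> s _; rewrite ffunE.
rewrite -(pair_bigA _ (fun k a => (zR k a).2%:R)) /=.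
apply: (@le_trans _ _ (\sum_(k < K) rho * dR%:R)).
  by apply: ler_sum => k _; case: (hR k).
by rewrite sumr_const card_ord -[_ *+ K]mulr_natl mulrCA.
Qed.

(** * Geometric prior on the grid *)

Definition grid_weight (R : realType) (I : finType) B (rho : R)
    (z : {ffun I -> bool * 'I_B}) : R :=
  \prod_i (expR (- ((z i).2%:R / rho)) / (2 * (1 + rho))).

Lemma grid_weight_ge0 (R : realType) (I : finType) B (rho : R)
    (z : {ffun I -> bool * 'I_B}) : 0 < rho -> 0 <= grid_weight rho z.
Proof.
move=> rho0; apply: prodr_ge0 => i _.
by rewrite divr_ge0 ?expR_ge0// mulr_ge0// addr_ge0// ltW.
Qed.

(** With [x = expR (- rho^-1) <= rho / (1 + rho)], the geometric series is at most
    [(1 - x)^-1 <= 1 + rho]. *)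
Lemma geometric_sum_le (R : realType) B (rho : R) : 0 < rho ->
  \sum_(k < B) expR (- (k%:R / rho)) <= 1 + rho.
Proof.
move=> rho0; set x := expR (- rho^-1).
have x0 : 0 < x := expR_gt0 _.
have hx : x * (1 + rho^-1) <= 1.
  rewrite /x expRN mulrC ler_pdivrMr ?expR_gt0// mul1r.
  exact: expR_ge1Dx.
have hx1 : 1 <= (1 - x) * (1 + rho).
  have : x * (1 + rho^-1) * rho <= rho by rewrite ler_piMl// ltW.
  by rewrite -mulrA mulrDl mul1r mulVf ?gt_eqF//; lra.
rewrite (eq_bigr (fun k : 'I_B => x ^+ k)); last first.
  by move=> k _; rewrite -expRM_natl mulrN.
have := subrX1 x B; set S := \sum_(k < B) _ => hS.
have : (1 - x) * S <= (1 - x) * (1 + rho).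
  by have := exprn_ge0 B (ltW x0); lra.
by rewrite ler_pM2l//; nra.
Qed.

(** In each coordinate, two signs times the geometric sum stay within the normalizer
    [2 * (1 + rho)]. *)
Lemma grid_weight_sum_le1 (R : realType) (I : finType) B (rho : R) :
  0 < rho -> \sum_(z : {ffun I -> bool * 'I_B}) grid_weight rho z <= 1.
Proof.
move=> rho0; have r1 : 0 < 2 * (1 + rho) by lra.
rewrite -(bigA_distr_bigA (fun (_ : I) (s : bool * 'I_B) =>
  expR (- (s.2%:R / rho)) / (2 * (1 + rho)))) /=.
apply: prodr_ile1 => i _; apply/andP; split.
  by apply: sumr_ge0 => s _; rewrite divr_ge0 ?expR_ge0// ltW.
rewrite -(pair_bigA _ (fun (_ : bool) (k : 'I_B) =>
  expR (- (k%:R / rho)) / (2 * (1 + rho)))) /= sum_bool -mulr_suml.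
rewrite -mulrDl ler_pdivrMr//.
by have := geometric_sum_le B rho0; lra.
Qed.

(** A budget of [rho] steps per coordinate on average costs a factor [expR 1] per coordinate,
    besides the normalizer. *)
Lemma grid_weight_ge (R : realType) (I : finType) B (rho : R)
    (z : {ffun I -> bool * 'I_B}) :
  0 < rho -> \sum_i (z i).2%:R <= rho * #|I|%:R ->
  expR (- (#|I|%:R * (1 + ln (2 * (1 + rho))))) <= grid_weight rho z.
Proof.
move=> rho0 hz; have r1 : 0 < 2 * (1 + rho) by lra.
have -> : grid_weight rho z =
    expR (\sum_i (- ((z i).2%:R / rho) - ln (2 * (1 + rho)))).
  rewrite expR_sum; apply: eq_bigr => i _.
  by rewrite expRB lnK.
rewrite ler_expR sumrB sumr_const -[ln _ *+ _]mulr_natl sumrN -mulr_suml.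
have : (\sum_i (z i).2%:R) / rho <= #|I|%:R by rewrite ler_pdivrMr// mulrC.
rewrite mulrDr; lra.
Qed.

Lemma card_coord N K dE dR : #|{: coord N K dE dR}| = (N * dE + K * dR)%N.
Proof. by rewrite card_sum !card_prod !card_ord. Qed.

(** * Scores and likelihoods on the parameter space *)

Section Score.
Context (R : realType) (N K dE dR : nat).
Context (cE : 'rV[R]_dE) (cR : 'rV[R]_dR) (U : R).
Context (phi : 'rV[R]_(dE + dE + dR) -> R).
Local Notation E := (eball cE U).
Local Notation W := (eball cR U).
Local Notation dom := (score_dom E W).
Implicit Types (x g : param R N K dE dR) (l : edge N K).

Lemma edge_param_dom x l : param_space E W x -> dom (edge_param x l).
Proof.
case=> xE xR; rewrite /edge_param; split;
  rewrite ?row_mxKl ?row_mxKr ?row_mxKl; [exact: xE|exact: xE|exact: xR].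
Qed.

(** Each of the three blocks of an edge moves by at most [D]; this is the source of [Num.sqrt 3] in
    the theorem. *)
Lemma edge_param_dist x g l (D : R) :
  0 <= D -> (forall i, enorm (x.1 i - g.1 i) <= D) ->
  (forall k, enorm (x.2 k - g.2 k) <= D) ->
  enorm (edge_param x l - edge_param g l) <= Num.sqrt 3 * D.
Proof.
move=> D0 hE hR; rewrite -ler_sqr ?nnegrE ?mulr_ge0 ?sqrtr_ge0 ?enorm_ge0//.
rewrite /edge_param !opp_row_mx !add_row_mx !enorm_row_mx exprMn.
rewrite [Num.sqrt 3 ^+ 2]sqr_sqrtr//.
have sqE i : enorm (x.1 i - g.1 i) ^+ 2 <= D ^+ 2.
  by rewrite ler_sqr ?nnegrE ?enorm_ge0.
have sqR k : enorm (x.2 k - g.2 k) ^+ 2 <= D ^+ 2.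
  by rewrite ler_sqr ?nnegrE ?enorm_ge0.
have := sqE l.1.1; have := sqE l.1.2; have := sqR l.2. lra.
Qed.

(** [sup] is 0 on a set without a supremum, so a positive value certifies that the scores are
    bounded. *)
Lemma score_le_bound u :
  0 < score_bound E W phi -> dom u -> `|phi u| <= score_bound E W phi.
Proof.
move=> C0 hu.
have [hs|/sup_out hs] := pselect (has_sup [set `|phi v| | v in dom]).
  by apply: ub_le_sup; [case: hs | exists u].
by move: C0; rewrite /score_bound hs ltxx.
Qed.

Lemma loglik_loglr (S : {set edge N K}) (y : edge N K -> bool) x g :
  loglik phi S y x - loglik phi S y g =
  \sum_(l in S) loglr (edge_prob phi x l) (edge_prob phi g l) (y l).
Proof.
rewrite /loglik -sumrB; apply: eq_bigr => l _; rewrite /loglr.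
by case: (y l) => /=; ring.
Qed.

Lemma edge_prob_itv x l : 0 < edge_prob phi x l < 1.
Proof. exact: sigmoid_itv. Qed.

Lemma kl_loss_ge0 x g : 0 <= kl_loss (edge_prob phi x) (edge_prob phi g).
Proof.
rewrite mulr_ge0 ?invr_ge0// sumr_ge0// => l _.
by rewrite bern_kl_ge0 ?edge_prob_itv.
Qed.

Lemma kl_loss_eq0 x g :
  (forall l, phi (edge_param x l) = phi (edge_param g l)) ->
  kl_loss (edge_prob phi x) (edge_prob phi g) = 0.
Proof.
move=> h; rewrite /kl_loss big1 ?mulr0// => l _.
rewrite /edge_prob h /bern_kl.
have /andP[p0 p1] := sigmoid_itv (phi (edge_param g l)).
by rewrite !divff ?ln1 ?mulr0 ?addr0// ?gt_eqF// subr_gt0.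
Qed.

(** In positive dimension the domain has two distinct points, obtained by shifting one center by [U]
    along an axis; a negative constant would fail there. *)
Lemma lipschitz_const_ge0 (alpha : R) :
  0 < U -> (0 < dE + dR)%N ->
  (forall u v, dom u -> dom v -> `|phi u - phi v| <= alpha * enorm (u - v)) ->
  0 <= alpha.
Proof.
move=> U0 hd hphi.
have c0 k (c : 'rV[R]_k) : eball c U c.
  rewrite /eball /= subrr enorm_le ?(ltW U0)// big1 ?sqr_ge0// => i _.
  by rewrite mxE expr0n.
have c1 k (c : 'rV[R]_k) i : eball c U (c + U *: delta_mx 0 i).
  rewrite /eball /= addrC addKr enorm_le ?(ltW U0)// (bigD1 i)//=.
  rewrite big1 => [|j ij].
    by rewrite !mxE !eqxx mulr1 addr0.
  by rewrite !mxE (negbTE ij) andbF mulr0 expr0n.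
suff [u [v [hu hv huv]]] : exists u v, [/\ dom u, dom v & 0 < enorm (u - v)].
  have := le_trans (normr_ge0 _) (hphi u v hu hv).
  by rewrite pmulr_lge0.
have gt0 k (w : 'rV[R]_k) i : w 0 i != 0 -> 0 < enorm w.
  move=> wi; rewrite sqrtr_gt0 (bigD1 i)//= ltr_pwDl//.
    by rewrite lt_def sqr_ge0 sqrf_eq0 wi.
  by rewrite sumr_ge0// => j _; exact: sqr_ge0.
have U1 k (c : 'rV[R]_k) (i : 'I_k) : (c + U *: delta_mx 0 i - c) 0 i != 0.
  by rewrite addrC addKr !mxE !eqxx mulr1 gt_eqF.
have [i|dE0] := pickP 'I_dE.
  exists (row_mx (row_mx (cE + U *: delta_mx 0 i) cE) cR),
    (row_mx (row_mx cE cE) cR).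
  split; rewrite /score_dom /= ?row_mxKl ?row_mxKr ?row_mxKl; first by split.
    by split.
  apply: (gt0 _ _ (lshift _ (lshift _ i))).
  by rewrite !opp_row_mx !add_row_mx !row_mxEl.
have hR : (0 < dR)%N.
  by case: (posnP dE) hd => [->//|h _]; have := dE0 (Ordinal h).
pose k := Ordinal hR.
exists (row_mx (row_mx cE cE) (cR + U *: delta_mx 0 k)),
  (row_mx (row_mx cE cE) cR).
split; rewrite /score_dom /= ?row_mxKl ?row_mxKr ?row_mxKl; first by split.
  by split.
apply: (gt0 _ _ (rshift _ k)).
by rewrite !opp_row_mx !add_row_mx !row_mxEr.
Qed.

End Score.

(** * Risk of the maximum likelihood estimator *)

Section Risk.
Context (R : realType) (N K dE dR : nat) (U : R).
Context (cE : 'rV[R]_dE) (cR : 'rV[R]_dR).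
Context (phi : 'rV[R]_(dE + dE + dR) -> R) (alpha : R).
Local Notation E := (eball cE U).
Local Notation W := (eball cR U).
Local Notation dom := (score_dom E W).
Local Notation C := (score_bound E W phi).
Local Notation n := (expected_obs N K).
Local Notation m := (param_dim R N K dE dR).
Hypothesis U0 : 0 < U.
Hypothesis alpha0 : 0 <= alpha.
Hypothesis hphi : forall u v, dom u -> dom v ->
  `|phi u - phi v| <= alpha * enorm (u - v).
Hypothesis hC : 2 <= C.
Context (gamma : R).
Hypothesis hgamma : 0 < gamma <= 1.
Hypothesis edges : (0 < #|{: edge N K}|)%N.
Context (xstar : param R N K dE dR).
Hypothesis hxstar : param_space E W xstar.

Lemma expected_obs_card : n gamma = gamma * #|{: edge N K}|%:R.
Proof.
by rewrite /expected_obs !card_prod !card_ord !natrM expr2 !mulrA.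
Qed.

Lemma expected_obs_gt0 : 0 < n gamma.
Proof.
rewrite expected_obs_card mulr_gt0 ?ltr0n//.
by case/andP: hgamma.
Qed.

Let grid B := {ffun 'I_N * 'I_dE + 'I_K * 'I_dR -> bool * 'I_B}.

Definition grid_prob B (rho : R) (z : grid B) (l : edge N K) : R :=
  edge_prob phi (grid_point U rho cE cR z) l.

Definition grid_mixture B (rho e : R) :=
  mixture (@grid_weight R _ B rho) gamma e (edge_prob phi xstar)
    (@grid_prob B rho).

(** A pointwise bound for each data configuration: the Hellinger sum of a grid point [g] near the
    maximizer is controlled by the mixture, converted to divergence, and carried back to the
    maximizer at cost [e]. *)
Lemma mle_loss_le_mixture B (rho e : R) (x : param R N K dE dR)
    (c : {ffun edge N K -> bool * bool}) :
  0 < rho -> (dE + dR)%:R * rho < B%:R ->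
  e = alpha * (Num.sqrt 3 * (U / rho)) ->
  is_mle E W phi [set l | (c l).2]%SET (fun l => (c l).1) x ->
  kl_loss (edge_prob phi x) (edge_prob phi xstar) <=
  8 * C * (e + m / n gamma * (1 + ln (2 * (1 + rho)))) + e +
  8 * C / n gamma * (grid_mixture B rho e c - 1).
Proof.
move=> rho0 hB he [xdom xmax]; have C2 := hC.
have [z [gdom hgE hgR hz]] := round_param U0 rho0 hB xdom.
set g := grid_point U rho cE cR z in gdom hgE hgR.
have xg l : `|phi (edge_param x l) - phi (edge_param g l)| <= e.
  apply: le_trans (hphi (edge_param_dom l xdom) (edge_param_dom l gdom)) _.
  rewrite he ler_wpM2l// edge_param_dist//.
  by rewrite divr_ge0// ltW.
have lrg l b : loglr (edge_prob phi x l) (edge_prob phi g l) b <= e.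
  exact: le_trans (loglr_sigmoid_le _ _ _) (xg l).
have lgr l b : loglr (edge_prob phi g l) (edge_prob phi x l) b <= e.
  by apply: le_trans (loglr_sigmoid_le _ _ _) _; rewrite distrC.
have l2C l b : loglr (edge_prob phi xstar l) (edge_prob phi g l) b <= 2 * C.
  apply: le_trans (loglr_sigmoid_le _ _ _) _.
  apply: le_trans (ler_normB _ _) _.
  have C0 : 0 < C by lra.
  have := score_le_bound C0 (edge_param_dom l hxstar).
  by have := score_le_bound C0 (edge_param_dom l gdom); lra.
(* The maximizer beats [xstar], and passing from it to [g] costs at most [e] on each observed
   edge. *)
have hS : 0 <= \sum_(l | (c l).2)
    (e + loglr (edge_prob phi g l) (edge_prob phi xstar l) (c l).1).
  have := xmax _ hxstar; rewrite -subr_ge0 loglik_loglr => h.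
  apply: (le_trans h); rewrite (eq_bigl (fun l => (c l).2)); last first.
    by move=> l; rewrite inE.
  apply: ler_sum => l _; have := lrg l (c l).1; rewrite /loglr ; lra.
have wz : expR (- (m * (1 + ln (2 * (1 + rho))))) <= grid_weight rho z.
  have mI : m = #|{: 'I_N * 'I_dE + 'I_K * 'I_dR}|%:R.
    by rewrite card_coord.
  by rewrite mI; apply: grid_weight_ge => //; rewrite -mI.
have := hellinger2_le_mixture gamma (fun z => grid_weight_ge0 z rho0) wz
  (q := @grid_prob B rho) hS.
rewrite -expected_obs_card -/(grid_mixture B rho e).
set M := grid_mixture B rho e c; set H := \sum_l hellinger2 _ _ => hH.
have n0 := expected_obs_gt0.
have K0 : 0 < #|{: edge N K}|%:R :> R by rewrite ltr0n.
have Hn : H / #|{: edge N K}|%:R <=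
    e + m / n gamma * (1 + ln (2 * (1 + rho))) + (M - 1) / n gamma.
  have -> : H / #|{: edge N K}|%:R = gamma * H / n gamma.
    have [g0 _] := andP hgamma.
    rewrite expected_obs_card; field.
    by rewrite !gt_eqF.
  rewrite ler_pdivrMr//; apply: (le_trans hH).
  by rewrite le_eqVlt; apply/orP; left; apply/eqP; field; rewrite gt_eqF.
have : kl_loss (edge_prob phi x) (edge_prob phi xstar) <=
    8 * C * (H / #|{: edge N K}|%:R) + e.
  rewrite /kl_loss mulrC ler_pdivrMr// mulrDl mulrA divfK ?gt_eqF//.
  rewrite mulr_sumr mulr_natr -sumr_const -big_split /=.
  apply: ler_sum => l _.
  apply: le_trans (bern_kl_perturb (q' := edge_prob phi g l) _ _ _ (lgr l)) _;
    rewrite ?edge_prob_itv//.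
  by rewrite lerD2r bern_kl_le_hellinger2// ?edge_prob_itv.
have C8 : 0 <= 8 * C by lra.
by have := ler_wpM2l C8 Hn; lra.
Qed.

Section Expectation.
Context (d : measure_display) (T : measurableType d) (P : probability T R).
Context (Y O : edge N K -> {RV P >-> bool}).
Hypothesis hmodel : network_model phi gamma xstar Y O.
Context (xhat : T -> param R N K dE dR).
Hypothesis hxhat : forall t,
  is_mle E W phi (observed O t) (fun l => Y l t) (xhat t).
Hypothesis hmeas : measurable_fun [set: T]
  (fun t => kl_loss (edge_prob phi (xhat t)) (edge_prob phi xstar)).

Lemma mle_risk (rho e : R) :
  0 < rho -> e = alpha * (Num.sqrt 3 * (U / rho)) -> e <= 1 ->
  ('E_P[fun t => kl_loss (edge_prob phi (xhat t)) (edge_prob phi xstar)] <=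
   (8 * C * (e + m / n gamma * (1 + ln (2 * (1 + rho)))) + e)%:E)%E.
Proof.
move=> rho0 he e1; have C2 := hC.
have e0 : 0 <= e by rewrite he !mulr_ge0 ?sqrtr_ge0 ?invr_ge0// ltW.
pose B := (Num.truncn ((dE + dR)%:R * rho)).+1.
have hB : (dE + dR)%:R * rho < B%:R.
  by case/andP: (truncn_itv (mulr_ge0 (ler0n R (dE + dR)) (ltW rho0))).
have n0 := expected_obs_gt0.
set b := 8 * C * _ + e.
apply: (@le_trans _ _ (\sum_c obs_prob (edge_prob phi xstar) gamma c *
  (b + 8 * C / n gamma * (grid_mixture B rho e c - 1)))%:E).
  apply: expectation_le_finite (measurable_config _ _)
    (prob_config hmodel hgamma) hmeas _ _ => t.
    exact: kl_loss_ge0.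
  apply: mle_loss_le_mixture => //.
  have := hxhat t; congr (is_mle _ _ _ _ _ _).
    by apply/setP => l; rewrite !inE ffunE.
  by apply/funext => l; rewrite ffunE.
rewrite lee_fin.
(* The bound is affine in the mixture, whose mean is at most 1, so its last term has nonpositive
   mean. *)
under eq_bigr do rewrite mulrDr mulrCA.
rewrite big_split /= -mulr_suml -mulr_sumr obs_prob_sum1 mul1r gerDl.
rewrite mulr_ge0_le0 ?divr_ge0 ?(ltW n0)//; first by lra.
under eq_bigr do rewrite mulrBr mulr1.
rewrite sumrB obs_prob_sum1 subr_le0 mixture_mean_le1//.
- by move=> l; exact: edge_prob_itv.
- by move=> z l; exact: edge_prob_itv.
- by rewrite e0.
- by move=> z; exact: grid_weight_ge0.
- exact: grid_weight_sum_le1.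
Qed.

End Expectation.
End Risk.

(** * Numerical estimates and the final bound *)

Lemma expR1_ge (R : realType) : 5 / 2 <= expR 1 :> R.
Proof.
(* The bound comes from [expR 1 >= (1 + 1 / 8) ^+ 8], estimated by three squarings. *)
have -> : 1 = 8%:R * (1 / 8) :> R by lra.
rewrite expRM_natl; have := expR_ge1Dx (1 / 8 : R); set a := expR _ => ha.
have -> : a ^+ 8 = ((a ^+ 2) ^+ 2) ^+ 2 by rewrite -!exprM.
have h2 : 5 / 4 <= a ^+ 2 by nra.
have h4 : 25 / 16 + 3 / 100 <= (a ^+ 2) ^+ 2.
  have : 81 / 64 <= a ^+ 2 by nra.
  nra.
nra.
Qed.

(* Here [ce = 8 sqrt 3 alpha U] and the resolution is [rho = r ^+ 2]. *)
Lemma risk_bound_le (R : realType) (C ce r : R) :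
  2 <= C -> 0 <= ce -> ce + expR 1 <= r ->
  8 * C * (ce / (8 * r ^+ 2) + r^-1 * (1 + ln (2 * (1 + r ^+ 2))))
    + ce / (8 * r ^+ 2) <= 36 * C * r^-1 * ln r.
Proof.
move=> hC ce0 hr; have e1 := expR1_ge R.
have r0 : 0 < r by lra.
have L1 : 1 <= ln r.
  by rewrite -[leLHS](expRK (1 : R)) ler_ln ?posrE ?expR_gt0//; lra.
(* Since [r >= 5 / 2], [2 * (1 + r ^+ 2) <= 5 / 2 * r ^+ 2 <= expR 1 * r ^+ 2]. *)
have hl : ln (2 * (1 + r ^+ 2)) <= 1 + 2 * ln r.
  rewrite -[leRHS]expRK ler_ln ?posrE ?expR_gt0//; last by nra.
  rewrite expRD -[2]/(2%:R) expRM_natl lnK ?posrE//.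
  have : 5 / 2 * r ^+ 2 <= expR 1 * r ^+ 2 by rewrite ler_wpM2r// sqr_ge0.
  nra.
have -> : ce / (8 * r ^+ 2) = r^-1 * (ce / r / 8).
  by field; rewrite gt_eqF.
have s0 : 0 <= ce / r by rewrite divr_ge0// ltW.
have s1 : ce / r <= 1 by rewrite ler_pdivrMr//; lra.
set s := ce / r in s0 s1 *; set l := ln _ in hl *; set L := ln r in L1 hl *.
have -> : 36 * C * r^-1 * L = r^-1 * (36 * C * L) by ring.
have -> : 8 * C * (r^-1 * (s / 8) + r^-1 * (1 + l)) + r^-1 * (s / 8) =
  r^-1 * (8 * C * (s / 8 + 1 + l) + s / 8) by ring.
rewrite ler_pM2l ?invr_gt0//.
(* As [L >= 1], the right side is at most [33 * C * L]; the remaining [3 * C * L] absorbs the last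
   [s / 8]. *)
have : 8 * C * (s / 8 + 1 + l) <= 8 * C * (1 / 8 + 2 + 2 * L).
  by rewrite ler_pM2l; lra.
nra.
Qed.

Theorem lemma2 (R : realType) (N K dE dR : nat)
  (U : R) (hU : 0 < U) (cE : 'rV[R]_dE) (cR : 'rV[R]_dR)
  (phi : 'rV[R]_(dE + dE + dR) -> R) (alpha : R)
  (hphi : forall u v,
     score_dom (eball cE U) (eball cR U) u ->
     score_dom (eball cE U) (eball cR U) v ->
     `|phi u - phi v| <= alpha * enorm (u - v))
  (hC : 2 <= score_bound (eball cE U) (eball cR U) phi)
  (gamma : R) (hgamma : 0 < gamma <= 1)
  (xstar : param R N K dE dR)
  (hxstar : param_space (eball cE U) (eball cR U) xstar)
  (d : measure_display) (T : measurableType d) (P : probability T R)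
  (Y O : edge N K -> {RV P >-> bool})
  (hmodel : network_model phi gamma xstar Y O)
  (xhat : T -> param R N K dE dR)
  (hxhat : forall t, is_mle (eball cE U) (eball cR U) phi
                       (observed O t) (fun l => Y l t) (xhat t))
  (hmeas : measurable_fun [set: T]
     (fun t => kl_loss (edge_prob phi (xhat t)) (edge_prob phi xstar))) :
  let n : R := expected_obs N K gamma in
  let m : R := param_dim R N K dE dR in
  let C : R := score_bound (eball cE U) (eball cR U) phi in
  let C1 : R := 18 * C in
  let C2 : R := 8 * Num.sqrt 3 * alpha * U in
  let C3 : R := 2 * Num.max C1 C2 in
  C2 + expR 1 <= n / m ->
  ('E_P[fun t => kl_loss (edge_prob phi (xhat t)) (edge_prob phi xstar)] <=
   (C3 * (m / n) * ln (n / m)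
    + C1 / n * expR (- (m * ln (n / m)))
    + 3 / n * expR (- (1 / 3) * (n + C3 * m * ln (n / m))))%:E)%E.
Proof.
move=> n m C C1 C2 C3 hr.
have C0 : 2 <= C := hC.
(* For the degenerate cases: without edges or in dimension 0, all parameters give the same scores
   and the loss vanishes. *)
have loss0 : (forall x l, phi (edge_param x l) = phi (edge_param xstar l)) ->
    'E_P[fun t => kl_loss (edge_prob phi (xhat t)) (edge_prob phi xstar)]%E
    = 0%E.
  move=> h; rewrite unlock integral0_eq// => t _.
  by rewrite kl_loss_eq0.
have C3C : 36 * C <= C3.
  have : 18 * C <= Num.max C1 C2 by rewrite le_max lexx.
  by rewrite /C3; lra.
have [edges0|edges] := posnP #|{: edge N K}|.
  have n0 : n = 0.
    have := expected_obs_card N K gamma; rewrite edges0 mulr0; exact.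
  rewrite loss0; first by rewrite n0 invr0 !(mulr0, mul0r) !addr0.
  by move=> x l; have := card0_eq edges0 l; rewrite inE.
have n0 : 0 < n by apply: expected_obs_gt0.
have tail0 : 0 <= C1 / n * expR (- (m * ln (n / m))) +
    3 / n * expR (- (1 / 3) * (n + C3 * m * ln (n / m))).
  rewrite addr_ge0// mulr_ge0 ?expR_ge0// divr_ge0 ?(ltW n0)//.
  by rewrite /C1; lra.
(* In dimension 0 the sign of [alpha] is unconstrained and [m = 0]: the first term vanishes and the
   nonnegative tail remains. *)
have [d0|d0] := posnP (dE + dR)%N.
  have /andP[/eqP dE0 /eqP dR0] : (dE == 0) && (dR == 0).
    by rewrite -addn_eq0 d0.
  have m0 : m = 0 by rewrite /m /param_dim dE0 dR0 !muln0.
  rewrite loss0; last first.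
    move=> x l; congr phi; apply/rowP => i.
    by have := ltn_ord i; rewrite [ltnRHS](_ : _ = 0%N)// dE0 dR0.
  have -> : C3 * (m / n) * ln (n / m) = 0 by rewrite m0 mul0r mulr0 mul0r.
  by rewrite lee_fin add0r.
have m0 : 0 < m.
  move: edges; rewrite !card_prod !card_ord !muln_gt0 ltr0n addn_gt0 !muln_gt0.
  by move: d0; rewrite addn_gt0 => /orP[] -> /andP[/andP[-> _] ->];
    rewrite ?orbT.
have alpha0 : 0 <= alpha := lipschitz_const_ge0 hU d0 hphi.
have C20 : 0 <= C2 by rewrite !mulr_ge0 ?sqrtr_ge0// ltW.
have e1 := expR1_ge R.
have r0 : 0 < n / m by rewrite divr_gt0.
have rho0 : 0 < (n / m) ^+ 2 by rewrite exprn_gt0.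
(* At resolution [rho = (n / m) ^+ 2] the rounding error [e] is [C2 / (8 * rho)], the 8 being the
   one in [C2]. *)
have he : C2 / (8 * (n / m) ^+ 2) = alpha * (Num.sqrt 3 * (U / (n / m) ^+ 2)).
  by rewrite /C2; move: (n / m) r0 => r r0; field; rewrite gt_eqF.
have he1 : C2 / (8 * (n / m) ^+ 2) <= 1.
  rewrite ler_pdivrMr; last by rewrite mulr_gt0.
  by move: (n / m) hr r0 => r hr' r0; nra.
apply: le_trans (mle_risk hU alpha0 hphi hC hgamma edges hxstar hmodel hxhat
  hmeas rho0 he he1) _.
rewrite lee_fin -[leRHS]addrA -[leLHS]addr0 lerD//.
have := risk_bound_le C0 C20 hr; rewrite invf_div => /le_trans; apply.
rewrite ler_wpM2r//; first by rewrite ln_ge0//; lra.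
by rewrite ler_wpM2r// divr_ge0// ltW.
Qed.
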